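(* Let $G^c$ be an edge-colored bipartite graph with bipartition $(A,B)$. If $d^c(u)\geq (3|B|+8)/5$ for each $u\in A$ and $d^c(v)\geq (3|A|+8)/5$ for each $v\in B$, then $G^c$ contains a rainbow cycle of length $4$.
   Context: $G$ is a finite simple graph and an edge-coloring is an arbitrary map $C:E(G)\to\mathbb{N}^{+}$ (not necessarily proper); $G^c$ denotes $G$ with such a coloring. The color degree $d^c(v)$ of a vertex $v$ is the number of distinct colors appearing on the edges incident to $v$. A subgraph is rainbow if all of its edges receive pairwise distinct colors. *)

(* Defs.v *)
From mathcomp Require Export all_boot all_order all_algebra.

Set Implicit Arguments.
Unset Strict Implicit.
Unset Printing Implicit Defensive.

Record sgraph := SGraph {
  svertex :> finType;
  adj : rel svertex;
  adj_sym : symmetric adj;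
  adj_irrefl : irreflexive adj
}.

Definition edge_set (G : sgraph) : {set {set G}} :=
  [set f | [exists x : G, exists y : G, adj x y && (f == [set x; y])]].

Definition edge (G : sgraph) := {f : {set G} | f \in edge_set G}.

Definition pos_nat := {n : nat | 0 < n}.

Definition edge_coloring (G : sgraph) := edge G -> pos_nat.

Definition color_degree (G : sgraph) (C : edge_coloring G) (v : G) : nat :=
  size (undup [seq C f | f : edge G <- enum {: edge G} & v \in sval f]).

Definition bipartition (G : sgraph) (A B : {set G}) : Prop :=
  [/\ A :|: B = [set: G], [disjoint A & B] &
      forall x y : G, adj x y ->
        (x \in A) && (y \in B) || (x \in B) && (y \in A)].

(* A cycle is listed by its successive distinct vertices, and its length is the
   size of the list; the bound rules out the degenerate closed walks x, y, x. *)
Definition graph_cycle (G : sgraph) (p : seq G) : Prop :=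
  2 < size p /\ ucycle (@adj G) p.

Definition cycle_edges (G : sgraph) (p : seq G) : {set edge G} :=
  [set f : edge G | [exists x : G, (x \in p) && (sval f == [set x; next p x])]].

Definition rainbow (G : sgraph) (C : edge_coloring G) (F : {set edge G}) : Prop :=
  {in F &, injective C}.

Definition has_rainbow_cycle (G : sgraph) (C : edge_coloring G) (k : nat) : Prop :=
  exists p : seq G,
    [/\ graph_cycle p, size p = k & rainbow C (cycle_edges p)].

(* Main.v *)
Require Import Defs.
From mathcomp Require Import all_boot all_order all_algebra.
From mathcomp Require Import zify lra.

(** Suppose there is no rainbow 4-cycle, and put m = |A|, n = |B|. For u in A
    let R(u) be a set of neighbours of u joined to u by distinct colors, one for
    each color at u. If x is in A, the vertices y of R(x) in R(u) with
    c(x,y) <> c(u,y) number at most 3: for two of them, y and z, the cycle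
    u y x z forces c(x,y) = c(u,z) or c(x,z) = c(u,y), and a tournament with
    all out-degrees at most 1 has at most 3 vertices. Hence at least
    |R(u)| + |R(x)| - n - 3 >= (n+1)/5 vertices y satisfy c(x,y) = c(u,y).
    On the other hand, for fixed y in B, all but w <= (2m-8)/5 vertices of A are
    joined to y by distinct colors, so at most w^2 + w ordered pairs u <> x
    satisfy c(x,y) = c(u,y). Double counting the triples (u,x,y) gives
    m (m-1) (n+1) / 5 <= n w (w+1), which is false. *)

Set Implicit Arguments.
Unset Strict Implicit.
Unset Printing Implicit Defensive.

Local Open Scope nat_scope.

(** * Representatives of the values of a map, and pairs with equal values *)

Lemma exists_injective_subseq (T K : eqType) (f : T -> K) (s : seq T) :
  exists2 r, {subset r <= s} & uniq (map f r) /\ map f r =i map f s.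
Proof.
elim: s => [|a s [r rs [Ur Er]]]; first by exists [::].
have [fas|fas] := boolP (f a \in map f s).
  exists r => [y /rs ys|]; first by rewrite inE ys orbT.
  by split=> // k; rewrite inE Er; case: eqP => [->|].
exists (a :: r) => [y|].
  by rewrite !inE => /orP[->//|/rs ->]; rewrite orbT.
by split=> [|k] /=; rewrite ?Er ?fas // !inE Er.
Qed.

Lemma uniq_map_injective (T K : eqType) (f : T -> K) (s : seq T) :
  uniq (map f s) -> {in s &, injective f}.
Proof.
move=> Us y z ys zs fyz; apply: contraTeq Us => yz.
have [i [j [ij js fij]]] :
    exists i j, [/\ i < j, j < size s & f (nth y s i) = f (nth y s j)].
  have [h|h|h] := ltngtP (index y s) (index z s).
  - by exists (index y s), (index z s); rewrite index_mem !nth_index.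
  - by exists (index z s), (index y s); rewrite index_mem !nth_index.
  - by rewrite -(nth_index y ys) h nth_index ?eqxx in yz.
apply/(uniqPn (f y)); exists i, j.
by split; rewrite ?size_map // !(nth_map y) // (ltn_trans ij).
Qed.

(** Let w be the size of the complement of [R]. A vertex u outside [R] has at most w - 1 partners
    outside [R] and one in [R], giving w * w pairs. If u lies in [R], its partners lie outside [R],
    and each of these serves at most one such u, giving w more. *)
Lemma leq_card_same_color_pairs (X : finType) (f : X -> nat) (R : {set X}) :
  {in R &, injective f} ->
  \sum_u #|[set x | (x != u) && (f x == f u)]| <= #|~: R| * #|~: R| + #|~: R|.
Proof.
move=> injR.
have le1 u : #|[set x in R | f x == f u]| <= 1.
  apply/card_le1_eqP => x y; rewrite !inE => /andP[xR /eqP ex] /andP[yR /eqP ey].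
  by apply: injR => //; rewrite ex ey.
rewrite (bigID (mem R)) /= addnC; apply: leq_add.
  rewrite -sum_nat_const.
  rewrite [leqLHS](eq_bigl (mem (~: R))); last by move=> u; rewrite !inE.
  apply: leq_sum => u uW; rewrite -(cardsID R) addnC.
  rewrite (cardsD1 u (~: R)) [u \in _]uW [leqRHS]addnC.
  apply: leq_add.
    by apply: subset_leq_card; apply/subsetP => x; rewrite !inE => /and3P[-> ->].
  apply: leq_trans (le1 u); apply: subset_leq_card; apply/subsetP => x.
  by rewrite !inE => /andP[/andP[_ ->] ->].
have sub u : u \in R ->
    #|[set x | (x != u) && (f x == f u)]| <= \sum_(x in ~: R) (f u == f x).
  move=> uR; rewrite -big_mkcondr /= sum1_card.
  apply: subset_leq_card; apply/subsetP => x.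
  rewrite !inE => /andP[xu /eqP fxu]; rewrite unfold_in /= inE fxu eqxx andbT.
  by apply: contra xu => xR; apply/eqP/injR.
apply: leq_trans (leq_sum _ sub) _; rewrite exchange_big /= -[leqRHS]muln1.
rewrite -sum_nat_const; apply: leq_sum => x _.
rewrite -big_mkcondr /= sum1_card; apply: leq_trans (le1 x).
by apply: subset_leq_card; apply/subsetP => u; rewrite !inE.
Qed.

(** * Rainbow 4-cycles in color matrices *)

(** In a color matrix [c], the value [0] encodes a non-edge. *)
Lemma card_color_agree_ge (X Y : finType) (c : X -> Y -> nat) (u x : X)
    (Ru Rx : {set Y}) :
  {in Ru &, injective (c u)} -> {in Rx &, injective (c x)} ->
  {in Ru, forall y, c u y != 0} -> {in Rx, forall y, c x y != 0} ->
  (forall y z, c u y != 0 -> c u z != 0 -> c x y != 0 -> c x z != 0 ->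
     ~~ uniq [:: c u y; c x y; c x z; c u z]) ->
  #|Ru| + #|Rx| <= #|Y| + #|[set y | c x y == c u y]| + 3.
Proof.
move=> injU injX nzU nzX norb.
pose S := [set y in Rx :&: Ru | c x y != c u y].
have pairS y z : y \in S -> z \in S -> y != z ->
    [/\ c u y <> c u z, c x y <> c x z & (c x y = c u z \/ c x z = c u y)].
  rewrite !inE => /andP[/andP[yX yU] ny] /andP[/andP[zX zU] nz] /eqP yz.
  have nu : c u y <> c u z by move/(injU _ _ yU zU).
  have nx : c x y <> c x z by move/(injX _ _ yX zX).
  split=> //.
  (* Consecutive edges of the cycle u y x z already differ in color, so a repeated color must occur
     on two opposite edges. *)
  move: (norb y z (nzU _ yU) (nzU _ zU) (nzX _ yX) (nzX _ zX)).
  rewrite /= !inE (eq_sym (c u y) (c x y)) (negPf ny) (negPf nz).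
  rewrite (introF eqP nu) (introF eqP nx) /= !orbF !andbT negb_and !negbK.
  by case/orP=> /eqP; auto.
have S3 : #|S| <= 3.
  rewrite cardE leqNgt; apply/negP => gt3.
  have memS y : y \in enum S -> y \in S by rewrite mem_enum.
  move: (enum_uniq S) gt3 memS.
  case: (enum S) => [|y1 [|y2 [|y3 [|y4 s]]]] //=.
  rewrite !inE !negb_or -!andbA.
  case/and5P=> n12 n13 n14 _ /and5P[n23 n24 _ n34 _] _ memS.
  have [m1 m2 m3 m4] : [/\ y1 \in S, y2 \in S, y3 \in S & y4 \in S].
    by split; apply: memS; rewrite !inE eqxx ?orbT.
  have [a1 a2 a3] := pairS _ _ m1 m2 n12.
  have [b1 b2 b3] := pairS _ _ m1 m3 n13.
  have [c1 c2 c3] := pairS _ _ m1 m4 n14.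
  have [d1 d2 d3] := pairS _ _ m2 m3 n23.
  have [e1 e2 e3] := pairS _ _ m2 m4 n24.
  have [f1 f2 f3] := pairS _ _ m3 m4 n34.
  (* Orient y to z when [c x y = c u z]. Six arcs on four vertices give some vertex two
     out-neighbors, against the injectivity of [c u]. *)
  by case: a3; case: b3; case: c3; case: d3; case: e3; case: f3; congruence.
have split : #|Rx| <= #|~: Ru| + (#|[set y | c x y == c u y]| + #|S|).
  rewrite -(cardsID Ru Rx) addnC; apply: leq_add.
    by apply: subset_leq_card; rewrite setDE subsetIr.
  rewrite -(cardsID [set y | c x y == c u y]); apply: leq_add.
    by rewrite subset_leq_card // subsetIr.
  by rewrite subset_leq_card //; apply/subsetP => y; rewrite !inE andbC.
have := cardsC Ru; lia.
Qed.

Lemma color_matrix_rainbow_C4 (X Y : finType) (c : X -> Y -> nat)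
    (RX : X -> {set Y}) (RY : Y -> {set X}) :
  0 < #|X| ->
  (forall x, {in RX x, forall y, c x y != 0}) ->
  (forall x, {in RX x &, injective (c x)}) ->
  (forall x, 3 * #|Y| + 8 <= 5 * #|RX x|) ->
  (forall y, {in RY y &, injective (c^~ y)}) ->
  (forall y, 3 * #|X| + 8 <= 5 * #|RY y|) ->
  exists u x y z,
    [/\ c u y != 0, c u z != 0, c x y != 0, c x z != 0
      & uniq [:: c u y; c x y; c x z; c u z]].
Proof.
move=> X0 nzX injX degX injY degY.
pose P u x y z := [&& c u y != 0, c u z != 0, c x y != 0, c x z != 0
  & uniq [:: c u y; c x y; c x z; c u z]].
have [/'exists_'exists_'exists_existsP[u [x [y [z /and5P H]]]]|norb] :=
  boolP [exists u, exists x, exists y, exists z, P u x y z].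
  by exists u, x, y, z.
exfalso.
have norbP u x y z : ~~ P u x y z.
  apply: contra norb => H.
  by apply/'exists_'exists_'exists_existsP; exists u, x, y, z.
(* The constant is 2 (3n + 8) - 5n - 15 = n + 1, with n = |Y|. *)
have agree u x : #|Y| + 1 <= 5 * #|[set y | c x y == c u y]|.
  have := degX u; have := degX x.
  suff : #|RX u| + #|RX x| <= #|Y| + #|[set y | c x y == c u y]| + 3 by lia.
  apply: card_color_agree_ge; rewrite ?nzX // => y z h1 h2 h3 h4.
  by have := norbP u x y z; rewrite /P h1 h2 h3 h4.
pose T := \sum_u \sum_(x | x != u) #|[set y | c x y == c u y]|.
have lowT : #|X| * (#|X|.-1 * (#|Y| + 1)) <= 5 * T.
  rewrite /T big_distrr /= -sum_nat_const; apply: leq_sum => u _.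
  rewrite big_distrr /= -(cardC1 u) -sum_nat_const.
  rewrite (eq_bigl (fun x => x != u)); last by move=> x; rewrite !inE.
  exact: leq_sum.
have cardR y : 5 * #|~: RY y| + 8 <= 2 * #|X|.
  by have := cardsC (RY y); have := degY y; lia.
(* For each y, 5w <= 2m - 8 gives 25 (w * w + w) = 5w (5w + 5) <= (2m - 8)(2m - 3). *)
have upT : 25 * T <= #|Y| * ((2 * #|X| - 8) * (2 * #|X| - 3)).
  have -> : T = \sum_y \sum_u #|[set x | (x != u) && (c x y == c u y)]|.
    rewrite exchange_big; apply: eq_bigr => u _ /=.
    transitivity (\sum_(x | x != u) \sum_y (c x y == c u y)).
      by apply: eq_bigr => x _; rewrite -big_mkcond /= sum1dep_card.
    rewrite exchange_big; apply: eq_bigr => y _ /=.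
    by rewrite -big_mkcondr /= sum1dep_card.
  rewrite big_distrr /= -sum_nat_const; apply: leq_sum => y _.
  have := leq_card_same_color_pairs (injY y); have := cardR y.
  by move: #|~: _| #|X| (\sum_u _) => w m t; nia.
have [u _] := card_gt0P X0.
(* From 3n + 8 <= 5 |[RX u]| <= 5n; the same bound for X makes the truncated subtraction 2m - 8
   exact. *)
have Y4 : 4 <= #|Y| by have := max_card (RX u); have := degX u; lia.
have [y _] := card_gt0P (ltn_trans (isT : 0 < 3) Y4).
have X4 : 4 <= #|X| by have := max_card (RY y); have := degY y; lia.
move: lowT upT; move: #|X| #|Y| T X4 Y4 => m n t m4 n4 low up.
have {low up} : 5 * (m * (m.-1 * (n + 1))) <= n * ((2 * m - 8) * (2 * m - 3)).
  by lia.
(* This yields m (m - 1)(n + 1) <= n m (m - 1), absurd as m (m - 1) > 0. *)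
have : n * ((2 * m - 8) * (2 * m - 3)) <= n * (5 * (m * m.-1)).
  by rewrite leq_mul2l; apply/orP; right; nia.
by nia.
Qed.

(** * From edge-colored graphs to color matrices *)

(** Colors are positive, so the default 0 marks exactly the non-edges. *)
Definition pair_color {G : sgraph} (C : edge_coloring G) (x y : G) : nat :=
  if insub [set x; y] : option (edge G) is Some e then sval (C e) else 0.

Lemma pair_colorC (G : sgraph) (C : edge_coloring G) (x y : G) :
  pair_color C x y = pair_color C y x.
Proof. by rewrite /pair_color setUC. Qed.

Lemma pair_colorE (G : sgraph) (C : edge_coloring G) (e : edge G) (x y : G) :
  sval e = [set x; y] -> pair_color C x y = sval (C e).
Proof. by move=> exy; rewrite /pair_color -exy valK. Qed.

Lemma adj_pair_color (G : sgraph) (C : edge_coloring G) (x y : G) :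
  pair_color C x y != 0 -> adj x y.
Proof.
rewrite /pair_color; case: insubP => // e he _ _; move: he; rewrite inE.
case/existsP=> a /existsP[b /andP[ab /eqP E]].
have nab : a != b by apply: contraTneq ab => ->; rewrite adj_irrefl.
have : x \in [set a; b] by rewrite -E !inE eqxx.
have : y \in [set a; b] by rewrite -E !inE eqxx orbT.
have : a \in [set x; y] by rewrite E !inE eqxx.
have : b \in [set x; y] by rewrite E !inE eqxx orbT.
rewrite !inE => bxy axy /orP[]/eqP ey /orP[]/eqP ex; subst x y => //.
- by move: bxy; rewrite orbb eq_sym (negPf nab).
- by rewrite adj_sym.
- by move: axy; rewrite orbb (negPf nab).
Qed.

Lemma bipartitionC (G : sgraph) (A B : {set G}) :
  bipartition A B -> bipartition B A.
Proof.
case=> AB dAB adjAB; split; rewrite 1?setUC 1?disjoint_sym // => x y /adjAB.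
by rewrite orbC.
Qed.

(** One neighbor of u is kept per color. All of them lie in B, so [R] can live in the subtype that
    indexes one side of the color matrix. *)
Lemma rainbow_neighbors (G : sgraph) (C : edge_coloring G) (A B : {set G})
    (u : G) :
  bipartition A B -> u \in A ->
  exists R : {set {y : G | y \in B}},
    [/\ {in R, forall y, pair_color C u (sval y) != 0},
        {in R &, injective (fun y => pair_color C u (sval y))}
      & color_degree C u <= #|R|].
Proof.
case=> _ dAB adjAB uA.
pose Y := {y : G | y \in B}.
pose f (y : Y) := pair_color C u (sval y).
pose s := [seq y <- enum {: Y} | f y != 0].
have [r rs [Ur Er]] := exists_injective_subseq f s.
exists [set y in r]; split.
- by move=> y; rewrite inE => /rs; rewrite mem_filter => /andP[].
- by move=> y z; rewrite !inE; apply: (uniq_map_injective Ur).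
- rewrite cardsE (card_uniqP (map_uniq Ur)) -(size_map f) /color_degree.
  rewrite -(size_map val).
  apply: uniq_leq_size; first by rewrite (map_inj_uniq val_inj) undup_uniq.
  move=> k /mapP[k'].
  rewrite mem_undup => /mapP[e]; rewrite mem_filter => /andP[ue _] -> ->.
  have := svalP e; rewrite inE => /existsP[a /existsP[b /andP[ab /eqP E]]].
  have [y uy Ey] : exists2 y, adj u y & sval e = [set u; y].
    move: ue; rewrite E !inE => /orP[]/eqP->; first by exists b.
    by exists a; rewrite 1?adj_sym // setUC.
  have yB : y \in B.
    have := adjAB _ _ uy; rewrite uA /= => /orP[//|/andP[uB _]].
    by rewrite (disjointFr dAB uA) in uB.
  rewrite Er; apply/mapP; exists (Sub y yB : Y).
    rewrite mem_filter mem_enum andbT /f /= (pair_colorE _ Ey) -lt0n.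
    exact: (svalP (C e)).
  by rewrite /f /= (pair_colorE _ Ey).
Qed.

Lemma rainbow_C4_of_pair_color (G : sgraph) (C : edge_coloring G) (a b a' b' : G) :
  pair_color C a b != 0 -> pair_color C a b' != 0 ->
  pair_color C a' b != 0 -> pair_color C a' b' != 0 ->
  uniq [:: pair_color C a b; pair_color C a' b; pair_color C a' b';
           pair_color C a b'] ->
  has_rainbow_cycle C 4.
Proof.
move=> /adj_pair_color ab /adj_pair_color ab' /adj_pair_color a'b
  /adj_pair_color a'b' Uc.
have adjN (x y : G) : adj x y -> (x == y) = false.
  by move=> xy; apply: contraTF xy => /eqP->; rewrite adj_irrefl.
(* Equal opposite vertices would merge two edges whose colors are assumed distinct. *)
have aa' : (a == a') = false.
  by apply: contraTF Uc => /eqP->; rewrite /= inE eqxx.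
have bb' : (b == b') = false.
  by apply: contraTF Uc => /eqP->; rewrite /= !inE eqxx !orbT.
have Up : uniq [:: a; b; a'; b'].
  rewrite /= !inE aa' bb' (adjN _ _ ab) (adjN _ _ ab') (adjN _ _ a'b').
  by rewrite eq_sym (adjN _ _ a'b).
exists [:: a; b; a'; b']; split=> //.
  by split=> //; rewrite /ucycle Up andbT /= ab (adj_sym b) a'b a'b' (adj_sym b') ab'.
have edgesE e : e \in cycle_edges [:: a; b; a'; b'] ->
    exists2 p, p \in [:: (a, b); (a', b); (a', b'); (a, b')]
      & sval e = [set p.1; p.2].
  rewrite inE => /existsP[x /andP[]]; rewrite !inE.
  case/or4P=> /eqP-> /eqP->; rewrite /= ?eqxx ?aa' ?bb' ?(adjN _ _ ab)
    ?(adjN _ _ a'b) ?(adjN _ _ a'b') 1?(eq_sym b a) ?(eq_sym a' a)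
    ?(eq_sym b' b) ?(eq_sym b' a) ?(eq_sym b' a') ?aa' ?bb' ?(adjN _ _ ab)
    ?(adjN _ _ ab') ?(adjN _ _ a'b').
  - by exists (a, b); rewrite ?inE ?eqxx.
  - by exists (a', b); rewrite ?inE ?eqxx ?orbT // setUC.
  - by exists (a', b'); rewrite ?inE ?eqxx ?orbT.
  - by exists (a, b'); rewrite ?inE ?eqxx ?orbT // setUC.
move=> e e' /edgesE[p pl Ep] /edgesE[q ql Eq] Cee'; apply: val_inj.
rewrite /= Ep Eq; suff -> : p = q by [].
(* The four pairs are listed in the order of the colors in [Uc], so edges of equal color come from
   the same pair. *)
apply: (uniq_map_injective (f := fun p => pair_color C p.1 p.2) _ pl ql) => //=.
by rewrite (pair_colorE C Ep) (pair_colorE C Eq) Cee'.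
Qed.

Local Open Scope ring_scope.

Theorem theorem10 (G : sgraph) (C : edge_coloring G) (A B : {set G})
    (G_nonempty : (0 < #|G|)%N)
    (bipAB : bipartition A B)
    (degA : forall u : G, u \in A ->
      (3 * #|B|%:R + 8) / 5 <= (color_degree C u)%:R :> rat)
    (degB : forall v : G, v \in B ->
      (3 * #|A|%:R + 8) / 5 <= (color_degree C v)%:R :> rat) :
  has_rainbow_cycle C 4.
Proof.
have natdeg (k d : nat) : (3 * k%:R + 8) / 5 <= d%:R :> rat ->
    (3 * k + 8 <= 5 * d)%N.
  by move=> h; rewrite -(Num.Theory.ler_nat rat) GRing.natrD !GRing.natrM; lra.
pose X := {x : G | x \in A}; pose Y := {y : G | y \in B}.
have cardX : #|{: X}| = #|A| by rewrite card_sig.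
have cardY : #|{: Y}| = #|B| by rewrite card_sig.
pose c (x : X) (y : Y) := pair_color C (sval x) (sval y).
have /fin_all_exists[RX RXP] (x : X) := rainbow_neighbors C bipAB (svalP x).
have /fin_all_exists[RY RYP] (y : Y) :=
  rainbow_neighbors C (bipartitionC bipAB) (svalP y).
have dX x : (3 * #|{: Y}| + 8 <= 5 * #|RX x|)%N.
  by have := natdeg _ _ (degA _ (svalP x)); have [_ _] := RXP x; rewrite cardY; lia.
have dY y : (3 * #|{: X}| + 8 <= 5 * #|RY y|)%N.
  by have := natdeg _ _ (degB _ (svalP y)); have [_ _] := RYP y; rewrite cardX; lia.
(* A vertex of B also forces A to be nonempty, since its degree bound provides neighbors in A. *)
have X0 : (0 < #|{: X}|)%N.
  have [v _] := card_gt0P G_nonempty; case: bipAB => AB _ _.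
  have : v \in A :|: B by rewrite AB inE.
  rewrite inE => /orP[vA|vB]; first by rewrite cardX; apply/card_gt0P; exists v.
  apply: leq_trans (max_card (RY (Sub v vB))).
  by have := dY (Sub v vB); lia.
have [|||u [x [y [z [uy uz xy xz Uc]]]]] :=
  @color_matrix_rainbow_C4 X Y c RX RY X0 _ _ dX _ dY.
- by move=> x; have [] := RXP x.
- by move=> x; have [] := RXP x.
- move=> y x x' xR x'R; rewrite /c ![pair_color C _ (sval y)]pair_colorC.
  by have [_ inj _] := RYP y; apply: inj.
exact: (rainbow_C4_of_pair_color uy uz xy xz Uc).
Qed.
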